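(* Let $\mathbb{F}$ be an algebraically closed field of characteristic zero and let $(\mathcal{P},\circ,\{\cdot,\cdot\})$ be a finite-dimensional transposed Poisson algebra over $\mathbb{F}$ such that $\mathcal{P}\circ\mathcal{P}=\mathcal{P}$. Then the Lie algebra $(\mathcal{P},\{\cdot,\cdot\})$ is solvable. In particular, if the associative commutative algebra $(\mathcal{P},\circ)$ is unital, then the Lie algebra $(\mathcal{P},\{\cdot,\cdot\})$ is solvable.
   Context: A transposed Poisson algebra is a vector space $\mathcal{P}$ with an associative commutative multiplication $\circ$ (not necessarily unital) and a Lie bracket $\{\cdot,\cdot\}$ such that $2x\circ\{y,z\}=\{x\circ y,z\}+\{y,x\circ z\}$ for all $x,y,z\in\mathcal{P}$. $\mathcal{P}\circ\mathcal{P}$ is the linear span of all products $a\circ b$ with $a,b\in\mathcal{P}$. *)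

(* Defs.v *)
From HB Require Import structures.
From mathcomp Require Import all_boot all_order all_algebra.
From mathcomp Require Export sesquilinear.

Set Implicit Arguments.
Unset Strict Implicit.
Unset Printing Implicit Defensive.

Import GRing.Theory.
Local Open Scope ring_scope.

(* The linear span of all f u v with u \in U and v \in V, given on bases as the
   library does for the product prodv of subspaces of an algebra; bprodvP and
   memv_bprod characterize it as the least subspace containing all these f u v. *)
Definition bprodv (F : fieldType) (P : vectType F)
    (f : {bilinear P -> P -> P}) (U V : {vspace P}) : {vspace P} :=
  <<[seq f u v | u <- vbasis U, v <- vbasis V]>>%VS.

Lemma memv_bprod (F : fieldType) (P : vectType F)
    (f : {bilinear P -> P -> P}) (U V : {vspace P}) (u v : P) :
  u \in U -> v \in V -> f u v \in bprodv f U V.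
Proof.
move=> uU vV; rewrite (coord_vbasis uU) (coord_vbasis vV) linear_sumr.
apply: memv_suml => j _; rewrite linearZr_LR; apply: memvZ.
rewrite linear_sumlz; apply: memv_suml => i _.
rewrite linearZl_LR; apply: memvZ; apply: memv_span.
by apply/allpairsP; exists ((vbasis U)`_i, (vbasis V)`_j);
   rewrite /= !mem_nth ?size_tuple ?ltn_ord.
Qed.

Lemma bprodvP (F : fieldType) (P : vectType F)
    (f : {bilinear P -> P -> P}) (U V W : {vspace P}) :
  reflect {in U & V, forall u v, f u v \in W} (bprodv f U V <= W)%VS.
Proof.
apply: (iffP idP) => [/subvP sW u v uU vV|fW].
  exact: (sW _ (memv_bprod f uU vV)).
apply/span_subvP => _ /allpairsP[[u v] /= [uU vV ->]].
by apply: fW; apply: vbasis_mem.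
Qed.

Definition is_lie_bracket (F : fieldType) (P : vectType F)
    (br : {bilinear P -> P -> P}) : Prop :=
  (forall x, br x x = 0) /\
  (forall x y z, br x (br y z) + br y (br z x) + br z (br x y) = 0).

Record transposed_poisson (F : fieldType) (P : vectType F)
    (mul br : {bilinear P -> P -> P}) : Prop := TransposedPoisson {
  tp_mulA : associative mul;
  tp_mulC : commutative mul;
  tp_lie : is_lie_bracket br;
  tp_compat : forall x y z,
    2%:R *: mul x (br y z) = br (mul x y) z + br y (mul x z)
}.

Definition unital (F : fieldType) (P : vectType F)
    (mul : {bilinear P -> P -> P}) : Prop :=
  exists e : P, left_id e mul /\ right_id e mul.

Definition derived_series (F : fieldType) (P : vectType F)
    (br : {bilinear P -> P -> P}) (n : nat) : {vspace P} :=
  iter n (fun U => bprodv br U U) fullv.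

Definition lie_solvable (F : fieldType) (P : vectType F)
    (br : {bilinear P -> P -> P}) : Prop :=
  exists n : nat, derived_series br n = 0%VS.

(* Main.v *)
Require Import Defs.
From HB Require Import structures.
From mathcomp Require Import all_boot all_order all_algebra.
From mathcomp Require Import ring.

Set Implicit Arguments.
Unset Strict Implicit.
Unset Printing Implicit Defensive.

Import GRing.Theory.
Local Open Scope ring_scope.

(** Why the theorem holds.

    A finite-dimensional commutative algebra that is equal to its own square
    has a unit (Nakayama's lemma, [idempotent_subspace_unit]), so both claims
    are about a unital algebra, with unit [e] say.  Put [D x = {e, x}].  The
    compatibility identity with [e] as one of its arguments reads
    [2 x o D y = {x, y} + D (x o y)]; together with the antisymmetry of the
    bracket it shows that [D] is a derivation ([derivation_br_unit]) and that
    the bracket is the Wronskian [{x, y} = x o D y - y o D x]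
    ([br_wronskian]).

    A derivation of a finite-dimensional commutative algebra in characteristic
    zero has nilpotent values ([derivation_nilpotent]).  Hence every element of
    [V = {P, P}] is nilpotent.  Moreover [V] is an ideal of the associative
    product, by the compatibility identity again, so that [V], [V o V],
    [(V o V) o (V o V)], ... reaches [0]: otherwise it would stop at a nonzero
    subspace equal to its own square, whose unit would be nilpotent
    ([nil_subalgebra_nilpotent]).

    The derived series is caught by this sequence.  If [W] is stable under [D],
    then the Wronskian formula gives [{W, W} <= W o W], and [W o W] is again
    stable under [D] by the Leibniz rule ([derived_series_sub]).  *)

(** * Derivations of commutative algebras *)

Lemma nilpotentD (R : comPzRingType) (x y : R) (m n : nat) :
  x ^+ m = 0 -> y ^+ n = 0 -> (x + y) ^+ (m + n) = 0.
Proof.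
move=> xm yn; rewrite exprDn big1 // => i _.
case: (leqP n i) => [ni|ltin].
  by rewrite -(subnK ni) (exprD y) yn mulr0 mulr0 mul0rn.
by rewrite -addnBA 1?ltnW // exprD xm !mul0r mul0rn.
Qed.

Lemma derivn_lead (R : nzRingType) (p : {poly R}) :
  p^`((size p).-1) = (lead_coef p *+ ((size p).-1)`!)%:P.
Proof.
apply/polyP => i; rewrite coef_derivn coefC.
case: eqVneq => [->|]; first by rewrite addn0 ffactnn.
rewrite -lt0n => i0; rewrite nth_default ?mul0rn //.
by rewrite (leq_trans (leqSpred _)) // -addn1 leq_add2l.
Qed.

Section Derivation.

Variables (F : fieldType) (A : comAlgType F) (D : {linear A -> A}).
Hypothesis DM : forall x y, D (x * y) = D x * y + x * D y.

Lemma derivation1 : D 1 = 0.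
Proof.
have /eqP := DM 1 1; rewrite !mul1r mulr1 -subr_eq0 opprD addNKr oppr_eq0.
by move/eqP.
Qed.

Lemma derivation_horner (p : {poly F}) (x : A) :
  D (horner_alg x p) = horner_alg x p^`() * D x.
Proof.
elim/poly_ind: p => [|p c IHp]; first by rewrite deriv0 !rmorph0 linear0 mul0r.
rewrite derivMXaddC !rmorphD !rmorphM /= linearD DM /= IHp horner_algX.
rewrite horner_algC linearZ /= derivation1 scaler0 addr0.
ring.
Qed.

(** The power rule for [D], multiplied by [x] so that no exponent [n - 1]
    occurs. *)
Lemma derivation_exp (x : A) (n : nat) : D (x ^+ n) * x = x ^+ n * D x *+ n.
Proof.
elim: n => [|n IHn]; first by rewrite derivation1 mul0r mulr0n.
rewrite exprS DM mulrDl -[x * D _ * x]mulrA IHn mulrS mulrnAr -mulrA.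
by congr (_ + _ *+ n); ring.
Qed.

(** Apply [D] to [p^(k)(x) (D x)^m = 0] and multiply by [D x].  By
    [derivation_exp] the term in which [D] falls on the power of [D x] is a
    multiple of the left-hand side itself, hence zero, and what remains is
    [p^(k+1)(x) (D x)^(m+2) = 0].  From [p(x) = 0] one arrives in this way at
    the derivative of order [deg p], which is a nonzero constant. *)
Lemma derivation_nilpotent (p : {poly F}) (x : A) :
    [pchar F] =i pred0 -> p != 0 -> horner_alg x p = 0 ->
  exists n, D x ^+ n = 0.
Proof.
move=> F0 p0 px.
have step k : exists m, horner_alg x p^`(k) * D x ^+ m = 0.
  elim: k => [|k [m IHk]]; first by exists 0; rewrite mulr1.
  exists m.+2; have := congr1 (fun u => D u * D x) IHk.
  rewrite linear0 mul0r DM derivation_horner -derivnS mulrDl.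
  rewrite -[_ * D (D x ^+ m) * _]mulrA derivation_exp mulrnAr mulrA IHk.
  by rewrite mul0r mul0rn addr0 => <-; rewrite !exprS; ring.
have [n] := step (size p).-1; rewrite derivn_lead horner_algC -scalerAl mul1r.
move/eqP; rewrite scaler_eq0 -mulr_natr mulf_eq0 lead_coef_eq0 (negPf p0) /=.
rewrite ((pcharf0P F).1 F0) eqn0Ngt fact_gt0 /= => /eqP Dxn.
by exists n.
Qed.

End Derivation.

(** * Subspaces equal to their own square *)

Section BilinearSpan.

Variables (F : fieldType) (P : vectType F) (f : {bilinear P -> P -> P}).
Implicit Types U V W : {vspace P}.

Lemma bprodvS U U' V V' :
  (U <= U')%VS -> (V <= V')%VS -> (bprodv f U V <= bprodv f U' V')%VS.
Proof.
move=> sU sV; apply/bprodvP => u v uU vV.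
by apply: memv_bprod; [apply: (subvP sU) | apply: (subvP sV)].
Qed.

Lemma linear_bprodv (phi : {linear P -> P}) U V W :
    {in U & V, forall u v, phi (f u v) \in W} ->
  {in bprodv f U V, forall x, phi x \in W}.
Proof.
move=> fW; suff /subvP sub : (bprodv f U V <= linfun phi @^-1: W)%VS.
  by move=> x /sub; rewrite -memv_preim lfunE.
by apply/bprodvP => u v uU vV; rewrite -memv_preim lfunE /= fW.
Qed.

End BilinearSpan.

Section IdempotentSubspace.

Variables (F : fieldType) (P : vectType F) (mul : {bilinear P -> P -> P}).
Hypotheses (mulA : associative mul) (mulC : commutative mul).
Implicit Types W : {vspace P}.

Lemma mem_bprod_cons W (b : P) (s : seq P) (x : P) :
  x \in bprodv mul W <<b :: s>> ->
  exists2 w, w \in W & x - mul w b \in bprodv mul W <<s>>.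
Proof.
suff /subvP sub : (bprodv mul W <<b :: s>> <=
    linfun (mul b) @: W + bprodv mul W <<s>>)%VS.
  move=> /sub/memv_addP[u /memv_imgP[w wW ->] [v vN ->]].
  by exists w; rewrite // lfunE /= mulC addrAC subrr add0r.
apply/bprodvP => u v uW; rewrite span_cons => /memv_addP[_ /vlineP[c ->]].
case=> t ts ->; rewrite linearDr linearZr_LR -linearZl_LR /=.
apply: memv_add; last exact: memv_bprod.
by rewrite mulC -[mul b _]lfunE memv_img ?memvZ.
Qed.

(** Nakayama's lemma for [W = W o W].  The induction removes the elements of a
    basis one at a time: it keeps an [a] in [W] such that [1 - a] maps [W] into
    the [W]-combinations of the elements of [s].  To remove the head [b] of
    [b :: s], write [(1 - a) b = c b] modulo the [W]-combinations of [s]; then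
    [(1 - a - c) (1 - a)] maps [W] into these combinations.  This factor is
    again of the form [1 - a'] with [a'] in [W], which makes sense although
    [P] itself may have no unit. *)
Lemma idempotent_subspace_unit W :
  bprodv mul W W = W -> exists2 a, a \in W & {in W, forall m, mul a m = m}.
Proof.
move=> WW.
have mulW : {in W &, forall u v, mul u v \in W}.
  by move=> u v uW vW; rewrite -WW memv_bprod.
have remove (s : seq P) : {subset s <= W} ->
    (exists2 a, a \in W &
       {in W, forall m, m - mul a m \in bprodv mul W <<s>>}) ->
  exists2 a, a \in W & {in W, forall m, mul a m = m}.
  elim: s => [|b s IHs] sW [a aW Ha].
    exists a => // m mW; apply/esym/eqP; rewrite -subr_eq0 -memv0.
    have /subvP -> // : (bprodv mul W <<[::]>> <= 0)%VS; last exact: Ha.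
    apply/bprodvP=> u v _; rewrite span_nil memv0 => /eqP->.
    by rewrite linear0r mem0v.
  have bW : b \in W by rewrite sW ?mem_head.
  have ssW : {subset s <= W} by move=> x xs; rewrite sW ?inE ?xs ?orbT.
  have [c cW Hc] := mem_bprod_cons (Ha b bW).
  set N := bprodv mul W <<s>> in Hc *.
  have mulN w : w \in W -> {in N, forall n, mul w n \in N}.
    move=> wW; apply: linear_bprodv => u v uW vs /=.
    by rewrite mulA memv_bprod ?mulW.
  apply: IHs => //; exists (a + (a + c) - mul (a + c) a).
    by rewrite !(memvB, memvD, mulW).
  move=> m mW; have [w wW Hw] := mem_bprod_cons (Ha m mW).
  set u := m - mul a m in Hw; set g := a + c.
  have -> : m - mul (a + g - mul g a) m = u - mul g u.
    rewrite linearBl linearDl linearBr /= -mulA.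
    by rewrite -[X in m - X]addrA opprD addrA.
  have -> : u - mul g u =
      u - mul w b - mul g (u - mul w b) + mul w (b - mul a b - mul c b).
    clearbody u; rewrite -[b - _ - _]addrA -opprD -linearDl -/g !linearBr /=.
    rewrite [mul w (mul g b)]mulA [mul w g]mulC -mulA.
    by rewrite opprB addrACA subrK addrAC subrr add0r.
  apply: memvD; last exact: mulN.
  by apply: memvB => //; apply: mulN => //; apply: memvD.
apply: (remove (vbasis W)) => [x|]; first exact: vbasis_mem.
exists 0; rewrite ?mem0v // => m mW.
by rewrite linear0l subr0 (span_basis (vbasisP W)) WW.
Qed.

(** The dimension drops at each squaring until the subspace is equal to its
    square; its unit [a] then fixes every [m], whereas some iterate of the
    multiplication by [a] is zero. *)
Lemma nil_subalgebra_nilpotent W :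
    (bprodv mul W W <= W)%VS ->
    {in W, forall a, exists n, forall z, iter n (mul a) z = 0} ->
  exists n, iter n (fun U => bprodv mul U U) W = 0%VS.
Proof.
have [d] := ubnP (\dim W); elim: d W => // d IHd W leWd sWW nilW.
have [WW|neWW] := eqVneq (bprodv mul W W) W.
  have [a aW Ha] := idempotent_subspace_unit WW; have [n an] := nilW a aW.
  exists 0; apply/eqP; rewrite -subv0; apply/subvP=> m mW.
  by rewrite memv0 -(an m) iter_fix ?Ha.
have [||u uWW|n Hn] := IHd (bprodv mul W W).
- rewrite -ltnS (leq_trans _ leWd) // ltnS ltn_neqAle dimvS // andbT.
  by apply: contraNneq neWW => eqd; rewrite eqEdim sWW eqd /=.
- exact: bprodvS.
- by apply: nilW; apply: (subvP sWW).
by exists n.+1; rewrite iterSr.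
Qed.

End IdempotentSubspace.

(** * The algebra structure given by a bilinear product with a unit *)

(** The hypotheses are parameters of this copy of [P] so that the algebra
    structure can be attached to the type by instance resolution. *)
Definition unital_algebra (F : fieldType) (P : vectType F)
    (mul : {bilinear P -> P -> P}) (e : P) (mulA : associative mul)
    (mulC : commutative mul) (mul1 : left_id e mul) (e0 : e != 0) : Type := P.

Section UnitalAlgebra.

Variables (F : fieldType) (P : vectType F) (mul : {bilinear P -> P -> P}).
Variables (e : P) (mulA : associative mul) (mulC : commutative mul).
Variables (mul1 : left_id e mul) (e0 : e != 0).
Local Notation A := (unital_algebra mulA mulC mul1 e0).

Lemma bilinear_mulDl : left_distributive mul +%R.
Proof. by move=> x y z; rewrite linearDl. Qed.

Lemma bilinear_scaleAl (k : F) (x y : P) : k *: mul x y = mul (k *: x) y.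
Proof. by rewrite linearZl_LR. Qed.

HB.instance Definition _ := Vector.on A.
HB.instance Definition _ :=
  GRing.Zmodule_isComNzRing.Build A mulA mulC mul1 bilinear_mulDl e0.
HB.instance Definition _ :=
  GRing.Lmodule_isLalgebra.Build F A bilinear_scaleAl.
HB.instance Definition _ := GRing.Lalgebra_isComAlgebra.Build F A.

(** Evaluation at [x] on the polynomials of degree at most [dim A] cannot be
    injective, for reasons of dimension. *)
Lemma unital_algebra_algebraic (x : A) :
  exists2 p : {poly F}, p != 0 & horner_alg x p = 0.
Proof.
pose ev (v : 'rV[F]_(\dim {:A}).+1) : A := horner_alg x (rVpoly v).
have ev_linear : linear ev.
  by move=> c u v; rewrite /ev linearP linearD linearZ /= -scalerAl mul1r.
pose evL : {linear 'rV[F]_(\dim {:A}).+1 -> A} :=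
  HB.pack ev (GRing.isLinear.Build F _ A *:%R ev ev_linear).
pose f := linfun evL.
have kerf : lker f != 0%VS.
  apply: contraTneq (dimvS (subvf (limg f))) => kerf0.
  by rewrite limg_dim_eq ?kerf0 ?capv0 // dimvf /dim /= mul1n ltnn.
exists (rVpoly (vpick (lker f))).
  apply: contraNneq kerf => p0; rewrite -vpick0.
  by rewrite -[vpick _]rVpolyK p0 linear0.
by have := memv_pick (lker f); rewrite memv_ker lfunE => /eqP.
Qed.

End UnitalAlgebra.

(** * Unital transposed Poisson algebras *)

Section UnitalTransposedPoisson.

Variables (F : fieldType) (P : vectType F) (mul br : {bilinear P -> P -> P}).
Variable e : P.
Hypotheses (F_char0 : [pchar F] =i pred0) (tpP : transposed_poisson mul br).
Hypothesis mul1 : left_id e mul.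

Let mulA := tp_mulA tpP.
Let mulC := tp_mulC tpP.

Let two_neq0 : 2%:R != 0 :> F.
Proof. by rewrite ((pcharf0P F).1 F_char0). Qed.

Lemma br_anti x y : br x y = - br y x.
Proof.
have [br0 _] := tp_lie tpP; have := br0 (x + y).
rewrite linearDl !linearDr /= !br0 addr0 add0r => /eqP.
by rewrite addr_eq0 => /eqP.
Qed.

Lemma br_unit_compat x y : br x y = mul x (br e y) *+ 2 - br e (mul x y).
Proof.
have := tp_compat tpP x e y; rewrite scaler_nat => ->.
by rewrite [mul x e]mulC mul1 addrK.
Qed.

(** Substituting [br_unit_compat] into [br x y = - br y x] gives twice the
    Leibniz rule. *)
Lemma derivation_br_unit x y :
  br e (mul x y) = mul (br e x) y + mul x (br e y).
Proof.
have /eqP := br_anti x y.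
rewrite (br_unit_compat x y) (br_unit_compat y x) [mul y x]mulC.
rewrite opprB subr_eq addrAC eq_sym subr_eq => /eqP E.
rewrite [mul (br e x) y]mulC; apply/eqP; rewrite -subr_eq0.
rewrite -(inj_eq (scalerI two_neq0)) scaler0 scaler_nat mulrnBl mulrnDl.
by rewrite [br _ (mul _ _) *+ 2]mulr2n E [X in _ - X]addrC subrr.
Qed.

Lemma br_wronskian x y : br x y = mul x (br e y) - mul y (br e x).
Proof.
rewrite br_unit_compat derivation_br_unit mulr2n opprD addrACA subrr addr0.
by rewrite [mul _ y]mulC.
Qed.

Let V := bprodv br fullv fullv.

(** The right-hand side of the compatibility identity is a sum of brackets, and
    [2] is invertible. *)
Lemma br_ideal x : {in V, forall v, mul x v \in V}.
Proof.
apply: linear_bprodv => y z _ _ /=.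
rewrite -[mul x _](scalerK two_neq0) memvZ // (tp_compat tpP).
by rewrite memvD // memv_bprod ?memvf.
Qed.

Lemma br_nil u : e != 0 -> u \in V -> exists n, forall z, iter n (mul u) z = 0.
Proof.
move=> e0; pose A := unital_algebra mulA mulC mul1 e0.
suff nilV : u \in V -> exists n, (u : A) ^+ n = 0.
  move=> /nilV[n un]; exists n => z.
  by rewrite [LHS](@iter_mulr A) un mul0r.
pose D : {linear A -> A} := HB.pack (br e : A -> A)
  (GRing.isLinear.Build F A A *:%R (br e) (linearP (br e))).
have DM (a b : A) : D (a * b) = D a * b + a * D b := derivation_br_unit a b.
have nilD (x y : A) : exists n, (x * D y) ^+ n = 0.
  have [p p0 py] := @unital_algebra_algebraic _ _ _ e mulA mulC mul1 e0 y.
  have [n yn] := derivation_nilpotent DM F_char0 p0 py.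
  by exists n; rewrite exprMn yn mulr0.
rewrite /V /bprodv => uV; rewrite [u](coord_span (X := in_tuple _) uV).
apply: (big_ind (fun v : A => exists n, v ^+ n = 0)).
- by exists 1%N; rewrite expr1.
- by move=> x y [m xm] [n yn]; exists (m + n)%N; apply: nilpotentD.
move=> i _; have [[y z] /= [_ _ ->]] := allpairsP (mem_nth 0 (ltn_ord i)).
rewrite br_wronskian; have [m ym] := nilD y z; have [n zn] := nilD z y.
exists (m + n)%N; rewrite exprZn.
suff -> : (mul y (br e z) - mul z (br e y) : A) ^+ (m + n) = 0.
  by rewrite scaler0.
by apply: nilpotentD => //; rewrite exprNn [X in _ * X]zn mulr0.
Qed.

Lemma derived_series_sub n :
  (derived_series br n.+1 <= iter n (fun U => bprodv mul U U) V)%VS.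
Proof.
set W := iter n _ V.
(* Stability under the derivation [br e] has to be carried along. *)
suff [//] : (derived_series br n.+1 <= W)%VS /\ {in W, forall w, br e w \in W}.
rewrite {}/W; elim: n => [|n [IHn DW]].
  by split=> // w wV; rewrite memv_bprod ?memvf.
rewrite [iter n.+1 _ _]iterS; set W := iter n _ V in IHn DW *; split.
  apply: subv_trans (bprodvS _ IHn IHn) _; apply/bprodvP => u v uW vW.
  by rewrite br_wronskian memvB ?memv_bprod ?DW.
apply: linear_bprodv => u v uW vW /=; rewrite derivation_br_unit.
by rewrite memvD ?memv_bprod ?DW.
Qed.

Lemma unital_lie_solvable : lie_solvable br.
Proof.
have [e0|e0] := eqVneq e 0.
  exists 0; apply/eqP; rewrite -subv0; apply/subvP => x _.
  by rewrite memv0 -[x]mul1 e0 linear0l.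
have [||n Vn] := @nil_subalgebra_nilpotent _ _ _ mulA mulC V.
- by apply/bprodvP => u v _; apply: br_ideal.
- by move=> u; apply: br_nil.
by exists n.+1; apply/eqP; rewrite -subv0 -Vn derived_series_sub.
Qed.

End UnitalTransposedPoisson.

Theorem corollary13 (F : closedFieldType) (F_char0 : [pchar F] =i pred0)
    (P : vectType F) (mul br : {bilinear P -> P -> P})
    (tpP : transposed_poisson mul br) :
  (bprodv mul fullv fullv = fullv -> lie_solvable br) /\
  (unital mul -> lie_solvable br).
Proof.
split=> [PP | [e [mul1 _]]]; last exact: unital_lie_solvable F_char0 tpP mul1.
have [e _ mul1] := idempotent_subspace_unit (tp_mulA tpP) (tp_mulC tpP) PP.
by apply: (unital_lie_solvable F_char0 tpP (e := e)) => x; rewrite mul1 ?memvf.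
Qed.
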